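(* Let $K$ be a field with a valuation $\mathrm{val}\colon K^*\to\mathbb R$ with value group $\Gamma=\mathrm{val}(K^* )$, for which there is a group homomorphism $\phi\colon\Gamma\to K^*$ with $\mathrm{val}(\phi(\gamma))=\gamma$ for all $\gamma\in\Gamma$. Let $L$ be an extension field of $K$ with a valuation $L^*\to\mathbb R$ that restricts to $\mathrm{val}$ on $K$. Let $Y\subseteq (K^* )^n$ be a closed subvariety of the $n$-dimensional torus over $K$, and let $Y_L=Y\times_{\mathrm{Spec}(K)}\mathrm{Spec}(L)$. Then $\mathrm{trop}(Y)=\mathrm{trop}(Y_L)$ as subsets of $\mathbb R^n$.
   Context: Here $(K^* )^n$ stands for the torus $\mathrm{Spec}\,K[x_1^{\pm1},\dots,x_n^{\pm1}]$; $Y$ is defined by its ideal $I\subseteq K[x_1^{\pm1},\dots,x_n^{\pm1}]$, and $Y_L$ is the closed subscheme of the torus over $L$ defined by the ideal $I_L=I\,L[x_1^{\pm1},\dots,x_n^{\pm1}]$. Tropicalization: for a field $F$ with a valuation $\mathrm{val}\colon F^*\to\mathbb R$ and a closed subscheme $Z$ of the torus defined by an ideal $J\subseteq F[x_1^{\pm1},\dots,x_n^{\pm1}]$, $\mathrm{trop}(Z)$ is the set of $w\in\mathbb R^n$ such that for every nonzero $f=\sum c_ux^u\in J$ the minimum $\min\{\mathrm{val}(c_u)+w\cdot u: c_u\neq 0\}$ is attained for at least two distinct exponents $u$. (Equivalently, when a splitting of the valuation exists, the set of $w$ for which the initial ideal $\mathrm{in}_w(J)$, generated over the residue field by the initial forms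 of the elements of $J$, is not the unit ideal.) *)

(* Defs.v *)
From HB Require Import structures.
From mathcomp Require Import all_boot all_order all_algebra.
From mathcomp Require Import finmap monalg.
From mathcomp Require Import classical_sets reals.

Set Implicit Arguments.
Unset Strict Implicit.
Unset Printing Implicit Defensive.

Import Order.TTheory GRing.Theory Num.Theory.

Local Open Scope fset_scope.
Local Open Scope ring_scope.

Section GroupAlgebra.
Variables (M : zmodType) (A : comNzRingType).

Local Notation T := {malg A[M]}.
Implicit Types (f g h : T) (u v : M) (d : {fset M}).

Definition galg_one : T := << 1 *g 0 >>.

Definition galg_mul f g : T :=
  \sum_(u <- msupp f) \sum_(v <- msupp g) << f@_u * g@_v *g u + v >>.

Lemma galg_mulE d1 d2 f g : msupp f `<=` d1 -> msupp g `<=` d2 ->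
  galg_mul f g
    = \sum_(u <- d1) \sum_(v <- d2) << f@_u * g@_v *g u + v >> :> T.
Proof.
move=> le1 le2; rewrite /galg_mul (big_fset_incl _ le1) /=.
  apply/eq_bigr=> u _; apply/big_fset_incl => // v _ /mcoeff_outdom ->.
  by rewrite mulr0 monalgU0.
move=> u _ /mcoeff_outdom fu.
by rewrite big1 => // v _; rewrite fu mul0r monalgU0.
Qed.

Lemma galg_mulC : commutative galg_mul.
Proof.
move=> f g; rewrite /galg_mul exchange_big /=; apply: eq_bigr => u _.
by apply: eq_bigr => v _; rewrite mulrC addrC.
Qed.

Lemma galg_mulDl : left_distributive galg_mul +%R.
Proof.
move=> f g h.
rewrite (galg_mulE (msuppD_le f g) (fsubset_refl (msupp h))).
rewrite (galg_mulE (fsubsetUl _ (msupp g)) (fsubset_refl (msupp h))).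
rewrite (galg_mulE (fsubsetUr (msupp f) _) (fsubset_refl (msupp h))).
rewrite -big_split /=; apply/eq_bigr=> u _.
rewrite -big_split /=; apply/eq_bigr=> v _.
by rewrite mcoeffD mulrDl monalgUD.
Qed.

Lemma galg_mulDr : right_distributive galg_mul +%R.
Proof. by move=> f g h; rewrite !(galg_mulC f) galg_mulDl. Qed.

Lemma galg_mul0l : left_zero 0 galg_mul.
Proof. by move=> f; rewrite /galg_mul msupp0 big_seq_fset0. Qed.

Lemma galg_mul0r : right_zero 0 galg_mul.
Proof. by move=> f; rewrite galg_mulC galg_mul0l. Qed.

Lemma galg_mulUU (a b : A) u v :
  galg_mul << a *g u >> << b *g v >> = << a * b *g u + v >>.
Proof. by rewrite (galg_mulE msuppU_le msuppU_le) !big_seq_fset1 !mcoeffUU. Qed.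

Lemma galg_mulUl (a : A) u g :
  galg_mul << a *g u >> g = \sum_(v <- msupp g) << a * g@_v *g u + v >>.
Proof.
rewrite (galg_mulE msuppU_le (fsubset_refl _)) big_seq_fset1.
by apply/eq_bigr => v _; rewrite mcoeffUU.
Qed.

Lemma galg_mul1 : left_id galg_one galg_mul.
Proof.
move=> f; rewrite galg_mulUl [RHS]monalgE.
by apply/eq_bigr => u _; rewrite mul1r add0r.
Qed.

Lemma galg_mulEl f g :
  galg_mul f g = \sum_(u <- msupp f) galg_mul << f@_u *g u >> g.
Proof. by apply/eq_bigr=> u _; rewrite galg_mulUl. Qed.

Lemma galg_mulEr f g :
  galg_mul f g = \sum_(v <- msupp g) galg_mul f << g@_v *g v >>.
Proof.
rewrite galg_mulC galg_mulEl; apply/eq_bigr => v _.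
by rewrite galg_mulC.
Qed.

Lemma galg_mul_suml (I : Type) (r : seq I) (F : I -> T) g :
  galg_mul (\sum_(i <- r) F i) g = \sum_(i <- r) galg_mul (F i) g.
Proof.
exact: (big_morph (galg_mul^~ g) (fun _ _ => galg_mulDl _ _ _)
  (galg_mul0l _)).
Qed.

Lemma galg_mul_sumr (I : Type) (r : seq I) (F : I -> T) f :
  galg_mul f (\sum_(i <- r) F i) = \sum_(i <- r) galg_mul f (F i).
Proof.
exact: (big_morph (galg_mul f) (fun _ _ => galg_mulDr _ _ _) (galg_mul0r _)).
Qed.

Lemma galg_mulA : associative galg_mul.
Proof.
move=> f g h.
rewrite (galg_mulEl f (galg_mul g h)) (galg_mulEl f g) galg_mul_suml.
apply/eq_bigr=> u _.
rewrite (galg_mulEl g h) galg_mul_sumr (galg_mulEr _ g) galg_mul_suml.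
apply/eq_bigr=> v _.
rewrite (galg_mulEr _ h) galg_mul_sumr (galg_mulEr _ h).
by apply/eq_bigr=> w _; rewrite !galg_mulUU mulrA addrA.
Qed.

Lemma galg_one_neq0 : galg_one != 0.
Proof. by rewrite monalgU_eq0 oner_eq0. Qed.

End GroupAlgebra.

(* monalg makes {malg A[M]} a ring only when the monoid M has no nontrivial   *)
(* units, which excludes Z^n. So the group algebra A[M] of an abelian group M *)
(* is the module of finitely supported functions M -> A under an alias that   *)
(* carries its own (convolution) product, and A[x_1^{+-1}, .., x_n^{+-1}] is  *)
(* A[Z^n]: << c *g u >> is the term c x^u, f@_u the coefficient of x^u in f,  *)
(* and msupp f the set of all u with f@_u != 0.                               *)
Definition group_algebra (M : zmodType) (A : comNzRingType) : Type :=
  {malg A[M]}.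

HB.instance Definition _ (M : zmodType) (A : comNzRingType) :=
  GRing.Lmodule.copy (group_algebra M A) {malg A[M]}.

HB.instance Definition _ (M : zmodType) (A : comNzRingType) :=
  GRing.Zmodule_isComNzRing.Build (group_algebra M A)
    (@galg_mulA M A) (@galg_mulC M A) (@galg_mul1 M A)
    (@galg_mulDl M A) (galg_one_neq0 M A).

Notation laurent n A := (group_algebra 'rV[int]_n A).

Definition map_laurent (n : nat) (A B : comNzRingType) (phi : A -> B)
    (f : laurent n A) : laurent n B :=
  \sum_(u <- msupp f) << phi f@_u *g u >>.

Record is_ideal (A : comNzRingType) (I : set A) : Prop := IsIdeal {
  ideal0 : I 0;
  idealD : forall a b, I a -> I b -> I (a + b);
  idealM : forall a b, I b -> I (a * b) }.

Definition extended_ideal (n : nat) (K L : fieldType) (iota : K -> L)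
    (I : set (laurent n K)) : set (laurent n L) :=
  smallest (@is_ideal (laurent n L)) (map_laurent iota @` I)%classic.

(* A valuation F^* -> R is a function on F whose value at 0 is irrelevant. *)
Record is_valuation (R : realType) (F : fieldType) (val : F -> R) : Prop :=
  IsValuation {
    valuationM : forall x y, x != 0 -> y != 0 -> val (x * y) = val x + val y;
    valuationD : forall x y, x != 0 -> y != 0 -> x + y != 0 ->
      Num.min (val x) (val y) <= val (x + y) }.

Definition value_group (R : realType) (F : fieldType) (val : F -> R) : set R :=
  (val @` [set x | x != 0])%classic.

(* phi is a homomorphism from the value group to F^* splitting val; its values *)
(* outside the value group are irrelevant.                                     *)
Record is_splitting (R : realType) (F : fieldType) (val : F -> R)
    (phi : R -> F) : Prop := IsSplitting {
  splitting_neq0 : forall a, value_group val a -> phi a != 0;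
  splittingD : forall a b, value_group val a -> value_group val b ->
    phi (a + b) = phi a * phi b;
  splittingK : forall a, value_group val a -> val (phi a) = a }.

Section Tropicalization.
Variables (R : realType) (n : nat) (F : fieldType) (val : F -> R).

Definition dot_int (w : 'rV[R]_n) (u : 'rV[int]_n) : R :=
  \sum_(i < n) w 0 i * (u 0 i)%:~R.

Definition term_weight (w : 'rV[R]_n) (f : laurent n F) (u : 'rV[int]_n) : R :=
  val f@_u + dot_int w u.

Definition attains_min (w : 'rV[R]_n) (f : laurent n F) (u : 'rV[int]_n) :
    Prop :=
  u \in msupp f /\
  (forall v, v \in msupp f -> term_weight w f u <= term_weight w f v).

Definition trop (J : set (laurent n F)) : set 'rV[R]_n :=
  [set w | forall f, J f -> f != 0 ->
     exists u v, [/\ u != v, attains_min w f u & attains_min w f v]]%classic.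

End Tropicalization.

(* Main.v *)
Require Import Defs.
From mathcomp Require Import all_boot all_order all_algebra.
From mathcomp Require Import finmap monalg.
From mathcomp Require Import classical_sets reals.
From mathcomp Require Import boolp ring lra.

(** Call a family (e_b), b in B, of elements of the ideal I reduced when
    e_b has coefficient 1 at b and 0 at the other elements of B, and attains
    its minimal weight at b. Gaussian elimination with pivots of minimal weight
    shows that finitely many elements of I lie in the span of a reduced family.
    An element F of the extended ideal is an L-combination of such elements, so
    F = sum_b F_b e_b. If F attained its minimum only at u, comparing weights
    at u gives u in B. The element e_u of I attains its minimum also at some
    s <> u, and there the term F_u e_u(s) has the weight of F at u and all other
    terms a larger one, so F attains its minimum at s as well. *)

Set Implicit Arguments.
Unset Strict Implicit.
Unset Printing Implicit Defensive.

Import Order.TTheory GRing.Theory Num.Theory.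

Local Open Scope fset_scope.
Local Open Scope ring_scope.

Local Notation monom c u := (<< c *g u >> : group_algebra _ _).

(** * Valuation bounds that include the zero element *)

Section Valuation.
Variables (R : realType) (F : fieldType) (val : F -> R).
Hypothesis valP : is_valuation val.

Lemma val1 : val 1 = 0.
Proof.
have := valuationM valP (oner_neq0 F) (oner_neq0 F).
by rewrite mulr1 => h; lra.
Qed.

Lemma valN x : x != 0 -> val (- x) = val x.
Proof.
move=> x0; have N10 : -1 != 0 :> F by rewrite oppr_eq0 oner_neq0.
have := valuationM valP N10 N10; rewrite mulrNN mulr1 val1 => h.
by rewrite -mulN1r (valuationM valP N10 x0); lra.
Qed.

(* These extend the valuation by val 0 = +oo. *)
Definition val_ge (m : R) (x : F) := (x != 0) ==> (m <= val x).
Definition val_gt (m : R) (x : F) := (x != 0) ==> (m < val x).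

Lemma val_gt0 m : val_gt m 0. Proof. by rewrite /val_gt eqxx. Qed.

Lemma val_geD m x y : val_ge m x -> val_ge m y -> val_ge m (x + y).
Proof.
rewrite /val_ge; have [->|x0] := eqVneq x 0; first by rewrite add0r.
have [->|y0] := eqVneq y 0; first by rewrite addr0 x0.
move=> /= hx hy; apply/implyP => xy0.
by rewrite (le_trans _ (valuationD valP x0 y0 xy0)) // le_min hx hy.
Qed.

Lemma val_gtD m x y : val_gt m x -> val_gt m y -> val_gt m (x + y).
Proof.
rewrite /val_gt; have [->|x0] := eqVneq x 0; first by rewrite add0r.
have [->|y0] := eqVneq y 0; first by rewrite addr0 x0.
move=> /= hx hy; apply/implyP => xy0.
by rewrite (lt_le_trans _ (valuationD valP x0 y0 xy0)) // lt_min hx hy.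
Qed.

Lemma val_geN m x : val_ge m (- x) = val_ge m x.
Proof. by rewrite /val_ge oppr_eq0; case: eqVneq => // /valN ->. Qed.

Lemma val_gtN m x : val_gt m (- x) = val_gt m x.
Proof. by rewrite /val_gt oppr_eq0; case: eqVneq => // /valN ->. Qed.

Lemma val_geM m k x y : val_ge m x -> val_ge k y -> val_ge (m + k) (x * y).
Proof.
rewrite /val_ge mulf_eq0 negb_or => /implyP hx /implyP hy.
apply/implyP => /andP[x0 y0].
by rewrite (valuationM valP x0 y0) lerD ?hx ?hy.
Qed.

Lemma val_gtM m k x y : val_gt m x -> val_ge k y -> val_gt (m + k) (x * y).
Proof.
rewrite /val_gt /val_ge mulf_eq0 negb_or => /implyP hx /implyP hy.
apply/implyP => /andP[x0 y0].
by rewrite (valuationM valP x0 y0) ltr_leD ?hx ?hy.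
Qed.

Lemma val_gt_sum (T : eqType) (r : seq T) (P : pred T) (G : T -> F) m :
    (forall i, i \in r -> P i -> val_gt m (G i)) ->
  val_gt m (\sum_(i <- r | P i) G i).
Proof.
move=> hG; rewrite big_seq_cond; apply: (big_ind (val_gt m)).
- exact: val_gt0.
- by move=> x y; apply: val_gtD.
- by move=> i /andP[]; apply: hG.
Qed.

Lemma val_gt_irrefl x : x != 0 -> ~~ val_gt (val x) x.
Proof. by move=> x0; rewrite /val_gt x0 ltxx. Qed.

Lemma valV x : x != 0 -> val x^-1 = - val x.
Proof.
move=> x0; have := valuationM valP x0 (invr_neq0 x0).
by rewrite divff // val1 => h; lra.
Qed.

End Valuation.

(** * Coefficients and supports in the group algebra *)

Section GroupAlgebraCoefficients.
Variables (M : zmodType) (A : comNzRingType).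
Implicit Types f g : group_algebra M A.

Lemma coeffD f g u : (f + g)@_u = f@_u + g@_u.
Proof. exact: (@mcoeffD M A). Qed.

Lemma coeffN f u : (- f)@_u = - f@_u.
Proof. exact: (@mcoeffN M A). Qed.

Lemma coeff_sum (T : Type) (r : seq T) (G : T -> group_algebra M A) u :
  (\sum_(i <- r) G i)@_u = \sum_(i <- r) (G i)@_u.
Proof. exact: (@raddf_sum _ _ (mcoeff u)). Qed.

Lemma coeff_mulU c u f t :
  (monom c u * f)@_t = c * f@_(t - u).
Proof.
rewrite -[_ * f]/(galg_mul << c *g u >> f) galg_mulUl raddf_sum /=.
have [tu|tu] := boolP (t - u \in msupp f).
  rewrite (bigD1_seq (t - u)) ?fset_uniq //= big1 ?addr0.
    by rewrite mcoeffU [u + _]addrC subrK eqxx.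
  move=> v ne; rewrite mcoeffU; case: eqP => // e.
  by rewrite -e addrC addKr eqxx in ne.
rewrite (mcoeff_outdom tu) mulr0 big_seq big1 // => v vf.
rewrite mcoeffU; case: eqP => // e.
by rewrite -e addrC addKr vf in tu.
Qed.

Lemma coeff_mul f g t :
  (f * g)@_t = \sum_(u <- msupp f) f@_u * g@_(t - u).
Proof.
rewrite -[f * g]/(galg_mul f g) galg_mulEl raddf_sum.
by apply: eq_bigr => u _; apply: coeff_mulU.
Qed.

Lemma group_algebra_neq0P f : reflect (exists u, f@_u != 0) (f != 0).
Proof.
apply: (iffP idP) => [f0|[u]]; last first.
  by apply: contraNneq => ->; rewrite mcoeff0.
have [/fset0Pn[u]|] := boolP (msupp f != fset0).
  by rewrite -mcoeff_neq0; exists u.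
rewrite negbK => /eqP supp0; case/eqP: f0; apply/malgP => u.
by rewrite mcoeff0 mcoeff_outdom // supp0.
Qed.

Lemma exists_min_supp (R : realType) (wt : M -> R) f : f != 0 ->
  exists2 s, s \in msupp f & forall t, t \in msupp f -> wt s <= wt t.
Proof.
case/group_algebra_neq0P => u; rewrite mcoeff_neq0 => uf.
case: (@arg_minP _ _ (msupp f) [` uf] predT (wt \o val)) => // i _ hi.
exists (val i) => [|t tf]; first exact: valP.
exact: (hi [` tf]).
Qed.

End GroupAlgebraCoefficients.

(** * Gaussian elimination over [K] with pivots of minimal weight *)

Section Elimination.
Variables (R : realType) (M : zmodType) (K : fieldType) (val : K -> R).
Hypothesis valP : is_valuation val.
Variables (wt : M -> R) (I : set (group_algebra M K)).
Hypothesis idealI : is_ideal I.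

Lemma ideal_scale c f : I f -> I (monom c 0 * f).
Proof. exact: idealM. Qed.

Lemma coeff_scale c (f : group_algebra M K) t :
  (monom c 0 * f)@_t = c * f@_t.
Proof. by rewrite coeff_mulU subr0. Qed.

(** As [(e b)@_b = 1] has valuation 0, the last field says that the weight of [e b] at any [t] is at
    least [wt b], its weight at [b]. *)
Record reduced_family (B : seq M) (e : M -> group_algebra M K) : Prop :=
  ReducedFamily {
    reduced_uniq : uniq B;
    reduced_ideal : forall b, b \in B -> I (e b);
    reduced_coeff : {in B &, forall b b', (e b)@_b' = (b == b')%:R};
    reduced_weight : {in B, forall b t, val_ge val (wt b - wt t) (e b)@_t} }.

(** For a reduced family the coordinates of [f] can only be its own coefficients on [B], so none are
    quantified. *)
Definition in_span (B : seq M) (e : M -> group_algebra M K)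
    (f : group_algebra M K) : Prop :=
  forall t, f@_t = \sum_(b <- B) f@_b * (e b)@_t.

(** One elimination step: reduce [f] modulo the family to [g], which vanishes on [B]. If [g] is
    nonzero, scale it to 1 at a point [s] of minimal weight, add it to the family and clear the
    coefficient at [s] in the old members. *)
Lemma reduced_family_extend B e f : reduced_family B e -> I f ->
  exists B' e', [/\ reduced_family B' e', in_span B' e' f
    & forall h, in_span B e h -> in_span B' e' h].
Proof.
move=> [uB Ie ce we] If.
pose g : group_algebra M K := f - \sum_(b <- B) monom f@_b 0 * e b.
have gE t : g@_t = f@_t - \sum_(b <- B) f@_b * (e b)@_t.
  by rewrite coeffD coeffN coeff_sum; under eq_bigr do rewrite coeff_scale.
have Ig : I g.
  rewrite /g -[_ - _]addrC -mulN1r; apply: (idealD idealI) => //.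
  apply: (idealM idealI); rewrite big_seq; apply: (big_ind I).
  - exact: ideal0.
  - exact: idealD.
  - by move=> b /Ie; apply: ideal_scale.
have gB b : b \in B -> g@_b = 0.
  move=> bB; rewrite gE (bigD1_seq b) //= ce // eqxx mulr1 big_seq_cond.
  rewrite big1 ?addr0 ?subrr // => c /andP[cB ne].
  by rewrite ce // (negbTE ne) mulr0.
have [g0|gn0] := eqVneq g 0.
  exists B, e; split=> // t; apply/eqP.
  by rewrite -subr_eq0 -gE g0 mcoeff0.
have [s sg smin] := exists_min_supp (fun t => val g@_t + wt t) gn0.
have gs0 : g@_s != 0 by rewrite mcoeff_neq0.
have sB : s \notin B by apply: contraNN gs0 => /gB ->.
pose g' : group_algebra M K := monom (g@_s)^-1 0 * g.
have g'E t : g'@_t = g@_t / g@_s by rewrite coeff_scale mulrC.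
pose e' b := if b == s then g' else e b - monom (e b)@_s 0 * g'.
have e's : e' s = g' by rewrite /e' eqxx.
have e'B b t : b \in B -> (e' b)@_t = (e b)@_t - (e b)@_s * g'@_t.
  move=> bB; rewrite /e' ifN ?coeffD ?coeffN ?coeff_scale //.
  by apply: contraNneq sB => <-.
(* This is where the minimality of the pivot [s] enters. *)
have wg' t : val_ge val (wt s - wt t) g'@_t.
  rewrite g'E /val_ge mulf_eq0 invr_eq0 (negbTE gs0) orbF; apply/implyP => gt0.
  rewrite (valuationM valP) ?invr_eq0 // (valV valP) //.
  have := smin t; rewrite -mcoeff_neq0 => /(_ gt0); lra.
(* The factor of [g'] is the defect of [h] at [s]: it is 0 for [h] in the old span, and [g@_s] for
   [h = f], which restores [g]. *)
have spanE h t : \sum_(b <- s :: B) h@_b * (e' b)@_t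
    = \sum_(b <- B) h@_b * (e b)@_t
      + (h@_s - \sum_(b <- B) h@_b * (e b)@_s) * g'@_t.
  rewrite big_cons e's mulrBl mulr_suml addrCA -sumrB; congr +%R.
  by rewrite !big_seq; apply: eq_bigr => b bB; rewrite e'B // mulrBr mulrA.
exists (s :: B), e'; split.
- split.
  + by rewrite /= sB.
  + move=> b; rewrite inE => /orP[/eqP->|bB].
      by rewrite e's; apply: ideal_scale.
    rewrite /e'; case: ifP => _; first exact: ideal_scale.
    apply: (idealD idealI); first exact: Ie.
    by rewrite -mulN1r; do 2!apply: (idealM idealI); apply: ideal_scale.
  + move=> b b'; rewrite !inE => /orP[/eqP->|bB] /orP[/eqP->|bB'].
    * by rewrite e's g'E divff // eqxx.
    * rewrite e's g'E gB // mul0r.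
      by case: eqP => // sb; rewrite sb bB' in sB.
    * rewrite e'B // g'E divff // mulr1 subrr.
      by case: eqP => // bs; rewrite -bs bB in sB.
    * by rewrite e'B // g'E gB // mul0r mulr0 subr0 ce.
  + move=> b; rewrite inE => /orP[/eqP->|bB] t; first by rewrite e's.
    rewrite e'B //; apply: (val_geD valP); first exact: we.
    rewrite (val_geN valP).
    (* The correction [(e b)@_s * g'@_t] passes through [s], and the two bounds add up to the one
       required. *)
    have -> : wt b - wt t = (wt b - wt s) + (wt s - wt t) by ring.
    by apply: (val_geM valP) => //; apply: we.
- move=> t; rewrite spanE -gE g'E mulrCA divff // mulr1 gE; ring.
- by move=> h hB t; rewrite spanE -!hB subrr mul0r addr0.
Qed.

Lemma exists_reduced_family (fs : seq (group_algebra M K)) :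
    (forall f, f \in fs -> I f) ->
  exists B e, reduced_family B e /\ forall f, f \in fs -> in_span B e f.
Proof.
elim: fs => [_|f fs IHfs Ifs]; first by exists [::], (fun=> 0).
have [g gfs|B [e [re se]]] := IHfs; first by apply: Ifs; rewrite inE gfs orbT.
have If : I f by apply: Ifs; rewrite mem_head.
have [B' [e' [re' sf sfs]]] := reduced_family_extend re If.
by exists B', e'; split=> // g; rewrite inE => /orP[/eqP->|/se /sfs].
Qed.

End Elimination.

(** * Elements of the extended ideal as [L]-combinations *)

Section Extension.
Variables (n : nat) (K L : fieldType) (iota : {rmorphism K -> L}).
Variables (I : set (laurent n K)).
Hypothesis idealI : is_ideal I.
Implicit Types (f : laurent n K) (F : laurent n L).

Lemma coeff_map_laurent f u : (map_laurent iota f)@_u = iota f@_u.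
Proof.
rewrite /map_laurent raddf_sum /=.
have [uf|uf] := boolP (u \in msupp f).
  rewrite (bigD1_seq u) ?fset_uniq //= mcoeffUU big1 ?addr0 // => v ne.
  by rewrite mcoeffU (negbTE ne).
rewrite (mcoeff_outdom uf) rmorph0 big_seq big1 // => v vf.
by rewrite mcoeffU; case: eqP => // vu; rewrite -vu vf in uf.
Qed.

Lemma msupp_map_laurent f u :
  (u \in msupp (map_laurent iota f)) = (u \in msupp f).
Proof. by rewrite -!mcoeff_neq0 coeff_map_laurent fmorph_eq0. Qed.

(** The [L]-combinations of elements of [I] form an ideal containing the image of [I], hence contain
    the smallest such ideal. *)
Lemma extended_ideal_comb F : extended_ideal iota I F ->
  exists2 s : seq (L * laurent n K), (forall p, p \in s -> I p.2)
    & forall t, F@_t = \sum_(p <- s) p.1 * iota p.2@_t.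
Proof.
pose comb G := exists2 s : seq (L * laurent n K),
  (forall p, p \in s -> I p.2)
  & forall t, G@_t = \sum_(p <- s) p.1 * iota p.2@_t.
move=> /(_ comb); apply; split; first split.
- by exists [::] => // t; rewrite big_nil mcoeff0.
- move=> f g [s Is Es] [r Ir Er]; exists (s ++ r) => [p|t].
    by rewrite mem_cat => /orP[/Is|/Ir].
  by rewrite coeffD Es Er big_cat.
- move=> a f [s Is Es].
  (* Each term of [a] is split: its coefficient goes into the scalar, its monomial is absorbed by
     [I]. *)
  exists [seq (a@_u * p.1, monom 1 u * p.2) | u <- msupp a, p <- s] => [p|t].
    by case/allpairsP => -[u q] /= [_ /Is Iq ->] /=; apply: idealM.
  rewrite coeff_mul big_allpairs_dep; apply: eq_bigr => u _.
  rewrite Es mulr_sumr; apply: eq_bigr => p _.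
  by rewrite coeff_mulU mul1r mulrA.
- move=> _ [f If <-]; exists [:: (1, f)] => [p|t].
    by rewrite inE => /eqP->.
  by rewrite big_seq1 mul1r coeff_map_laurent.
Qed.

(** A single reduced family over [K] spans the finitely many elements of [I] that occur in [F];
    collecting the scalars at each [b] gives [F@_b]. *)
Lemma extended_ideal_span (R : realType) (val : K -> R)
    (wt : 'rV[int]_n -> R) F :
    is_valuation val -> extended_ideal iota I F ->
  exists B e, reduced_family val wt I B e
    /\ forall t, F@_t = \sum_(b <- B) F@_b * iota (e b)@_t.
Proof.
move=> valP /extended_ideal_comb[s Is Fs].
have [f /mapP[p /Is Ip ->] //|B [e [re se]]] :=
  exists_reduced_family valP wt idealI (fs := [seq p.2 | p <- s]).
exists B, e; split=> // t; rewrite Fs big_seq.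
under eq_bigr => p ps do
  rewrite (se p.2 (map_f _ ps) t) raddf_sum mulr_sumr.
rewrite -big_seq exchange_big /=; apply: eq_bigr => b _.
rewrite Fs mulr_suml; apply: eq_bigr => p _.
by rewrite rmorphM mulrA.
Qed.

End Extension.

(** Off the support the bound is vacuous; on it, equality would make [v] a second minimizer. *)
Lemma unique_min_val_gt (R : realType) (n : nat) (F : fieldType) (val : F -> R)
    (w : 'rV[R]_n) (f : laurent n F) u :
    attains_min val w f u -> (forall v, attains_min val w f v -> v = u) ->
  forall v, v != u ->
    val_gt val (term_weight val w f u - dot_int w v) f@_v.
Proof.
move=> [uf umin] uniq_u v vu; apply/implyP; rewrite mcoeff_neq0 => vf.
rewrite ltrBlDr lt_neqAle umin // andbT; apply: contraNneq vu => uv.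
by apply/eqP/uniq_u; split=> // t /umin; rewrite uv.
Qed.

(** * Equality of the two tropicalizations *)

Theorem corollary2p12 (R : realType) (n : nat)
    (K : fieldType) (valK : K -> R) (valKP : is_valuation valK)
    (splitK : exists phi : R -> K, is_splitting valK phi)
    (L : fieldType) (iota : {rmorphism K -> L})
    (valL : L -> R) (valLP : is_valuation valL)
    (valLK : forall x : K, x != 0%R -> valL (iota x) = valK x)
    (I : set (laurent n K)) (idealI : is_ideal I) :
  trop valK I = trop valL (extended_ideal iota I).
Proof.
apply/seteqP; split=> w tw F.
  move=> IF F0.
  have [B [e [[uB Ie ce we] FE]]] :=
    extended_ideal_span idealI (dot_int w) valKP IF.
  have [u uF umin] := exists_min_supp (term_weight valL w F) F0.
  have uM : attains_min valL w F u by [].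
  apply: contrapT => no_pair.
  have uniq_u v : attains_min valL w F v -> v = u.
    move=> vM; apply: contrapT => /eqP vu; apply: no_pair.
    by exists v, u.
  set m := term_weight valL w F u.
  have gt_m := unique_min_val_gt uM uniq_u.
  have Fu0 : F@_u != 0 by rewrite mcoeff_neq0.
  have ge_e b t : b \in B ->
      val_ge valL (dot_int w b - dot_int w t) (iota (e b)@_t).
    move=> /we/(_ t)/implyP h; apply/implyP; rewrite fmorph_eq0 => et0.
    by rewrite valLK ?h.
  (* Only the term of index [u] can have weight as small as [m], at whatever exponent [t]. *)
  have gt_term b t : b \in B -> b != u ->
      val_gt valL (m - dot_int w t) (F@_b * iota (e b)@_t).
    move=> bB bu.
    have -> : m - dot_int w t
        = (m - dot_int w b) + (dot_int w b - dot_int w t) by ring.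
    by apply: (val_gtM valLP); [apply: gt_m | apply: ge_e].
  (* If [u] were outside [B], every term of [F@_u] would have weight above [m], the weight of [F] at
     [u]. *)
  have [uB'|uB'] := boolP (u \in B); last first.
    have /negP := val_gt_irrefl valL Fu0; apply.
    have -> : valL F@_u = m - dot_int w u by rewrite /m /term_weight addrK.
    rewrite FE; apply: (val_gt_sum valLP) => b bB _; apply: gt_term => //.
    by apply: contraNneq uB' => <-.
  have eu1 : (e u)@_u = 1 by rewrite ce // eqxx.
  have eu0 : e u != 0.
    by apply/group_algebra_neq0P; exists u; rewrite eu1 oner_neq0.
  (* The assumption on [w] is applied to [e u]: of its two minimizers at least one differs from
     [u]. *)
  have [s su [se smin]] : exists2 s, s != u & attains_min valK w (e u) s.
    have [s [t [st hs ht]]] := tw _ (Ie _ uB') eu0.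
    have [su|] := eqVneq s u; last by exists s.
    by exists t; rewrite // eq_sym -su.
  have es0 : (e u)@_s != 0 by rewrite mcoeff_neq0.
  have val_es : valK (e u)@_s <= dot_int w u - dot_int w s.
    have := smin u; rewrite -mcoeff_neq0 eu1 oner_neq0 => /(_ isT).
    by rewrite /term_weight eu1 (val1 valKP); lra.
  have ies0 : iota (e u)@_s != 0 by rewrite fmorph_eq0.
  (* Both [F@_s] and the terms with [b != u] have weight above [m] at [s], hence so does the
     remaining term; but [val_es] bounds its weight by [m]. *)
  have : val_gt valL (m - dot_int w s) (F@_u * iota (e u)@_s).
    have -> : F@_u * iota (e u)@_s
        = F@_s - \sum_(b <- B | b != u) F@_b * iota (e b)@_s.
      by rewrite [F@_s]FE (bigD1_seq u) //= addrK.
    apply: (val_gtD valLP); first exact: gt_m.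
    rewrite (val_gtN valLP); apply: (val_gt_sum valLP) => b bB bu.
    exact: gt_term.
  rewrite /val_gt mulf_eq0 negb_or Fu0 ies0 /= (valuationM valLP) // valLK //.
  by rewrite /m /term_weight => lt_es; move: val_es lt_es; clear; lra.
(* Converse inclusion: the image of [F] lies in the extended ideal and has the same support and
   weights. *)
move=> IF F0; pose G := map_laurent iota F.
have IG : extended_ideal iota I G.
  by move=> J [_ sub]; apply: sub; exists F.
have G0 : G != 0.
  case/group_algebra_neq0P: F0 => u Fu.
  by apply/group_algebra_neq0P; exists u; rewrite coeff_map_laurent fmorph_eq0.
have weightG u : u \in msupp F ->
    term_weight valL w G u = term_weight valK w F u.
  rewrite -mcoeff_neq0 => Fu.
  by rewrite /term_weight coeff_map_laurent valLK.
have minG u : attains_min valL w G u -> attains_min valK w F u.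
  move=> [uG umin].
  have uF : u \in msupp F by rewrite -(msupp_map_laurent iota).
  split=> // v vF; rewrite -!weightG //.
  by apply: umin; rewrite msupp_map_laurent.
by have [u [v [uv /minG uM /minG vM]]] := tw _ IG G0; exists u, v.
Qed.
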